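(* Let $Q$ be a locally compact Hausdorff topological quasigroup satisfying the identity $$((xy)z)y = x(y(zy)) \qquad \text{for all } x,y,z\in Q.$$ Assume that $\mu$ is a nonzero regular Borel measure on $Q$ and that $j,\rho:Q\to\mathbb{R}_{>0}$ are functions such that, for every $a\in Q$, $$(L_a)_*\mu = j(a)\,\mu, \qquad (R_a)_*\mu=\rho(a)\,\mu.$$ Then, for all $x,y\in Q$, $$j(xy)\,\rho(y)=j(x)\,j(y)\,\rho(y),$$ and hence $j(xy)=j(x)j(y)$.
   Context: A quasigroup is a set $Q$ with a binary operation $(x,y)\mapsto xy$ such that for all $a,b\in Q$ there are unique $x,y\in Q$ with $ax=b$ and $ya=b$. A topological quasigroup is a quasigroup with a Hausdorff topology such that multiplication and both division operations are continuous. The translations are $L_a(x)=ax$ and $R_a(x)=xa$; each is a homeomorphism of $Q$. For a measurable map $T:Q\to Q$, the push-forward is $(T_*\mu)(E)=\mu(T^{-1}(E))$ for Borel sets $E$. ''Regular Borel measure'' is understood in the usual sense for locally compact Hausdorff spaces: a Borel measure that is finite on compact sets, outer regular on Borel sets, and inner regular (by compact sets) on open sets. *)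

(* Defs.v *)
From HB Require Import structures.
From mathcomp Require Import all_boot all_order all_algebra.
From mathcomp Require Import all_classical all_reals all_analysis.

Set Implicit Arguments.
Unset Strict Implicit.
Unset Printing Implicit Defensive.

Import Order.TTheory GRing.Theory Num.Theory.

Local Open Scope classical_set_scope.
Local Open Scope ring_scope.
Local Open Scope ereal_scope.

Section TopologicalQuasigroup.
Context {Q : ptopologicalType}.
Implicit Type op : Q -> Q -> Q.

Definition quasigroup op : Prop :=
  forall a b : Q, (exists! x, op a x = b) /\ (exists! y, op y a = b).

(* [get] returns the point of Q when no solution exists; in a quasigroup
   [ldiv op a b] and [rdiv op b a] are the unique solutions of a x = b and
   y a = b, see [ldivP] and [rdivP]. *)
Definition ldiv op (a b : Q) : Q := get [set x | op a x = b].
Definition rdiv op (b a : Q) : Q := get [set y | op y a = b].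

Lemma ldivP op : quasigroup op ->
  forall a b x, op a x = b <-> x = ldiv op a b.
Proof.
move=> qop a b x; have [[z [az uz]] _] := qop a b.
have ld : op a (ldiv op a b) = b by exact: (@getI Q [set x | op a x = b] z az).
by split=> [ax|-> //]; rewrite -(uz _ ax) -(uz _ ld).
Qed.

Lemma rdivP op : quasigroup op ->
  forall a b y, op y a = b <-> y = rdiv op b a.
Proof.
move=> qop a b y; have [_ [z [za uz]]] := qop a b.
have rd : op (rdiv op b a) a = b by exact: (@getI Q [set y | op y a = b] z za).
by split=> [ya|-> //]; rewrite -(uz _ ya) -(uz _ rd).
Qed.

Record topological_quasigroup op : Prop := {
  tq_quasigroup : quasigroup op ;
  tq_hausdorff : hausdorff_space Q ;
  tq_mul_continuous : continuous (fun p : Q * Q => op p.1 p.2) ;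
  tq_ldiv_continuous : continuous (fun p : Q * Q => ldiv op p.1 p.2) ;
  tq_rdiv_continuous : continuous (fun p : Q * Q => rdiv op p.1 p.2) }.

End TopologicalQuasigroup.

(* Measurable types are pointed in the library, whence [ptopologicalType]
   rather than [topologicalType]; a space carrying a nonzero measure is
   nonempty in any case. *)
Notation borel Q := (g_sigma_algebraType (@open Q)).

Definition ltranslation (Q : ptopologicalType) (op : Q -> Q -> Q) (a : Q) :
  borel Q -> borel Q := fun x => op a x.

Definition rtranslation (Q : ptopologicalType) (op : Q -> Q -> Q) (a : Q) :
  borel Q -> borel Q := fun x => op x a.

Section BorelMeasure.
Context {R : realType} {Q : ptopologicalType}.
Implicit Type mu : {measure set (borel Q) -> \bar R}.

Record regular_borel_measure mu : Prop := {
  rbm_compact_finite : forall K : set Q, compact K -> mu K < +oo ;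
  rbm_outer_regular : forall E : set (borel Q), measurable E ->
    mu E = ereal_inf [set mu U | U in [set U : set Q | open U /\ E `<=` U]] ;
  rbm_inner_regular : forall U : set Q, open U ->
    mu U = ereal_sup [set mu K | K in [set K : set Q | compact K /\ K `<=` U]] }.

(* A library measure is a function on all subsets whose values outside the
   sigma-algebra are unconstrained, so measures are compared on Borel sets
   only, here and in [pushforward_scales]. *)
Definition nonzero_measure mu : Prop :=
  exists2 E : set (borel Q), measurable E & mu E != 0.

Definition pushforward_scales mu (T : borel Q -> borel Q) (c : R) : Prop :=
  forall E : set (borel Q), measurable E -> pushforward mu T E = c%:E * mu E.

End BorelMeasure.

(* Main.v *)
Require Import Defs.
From HB Require Import structures.
From mathcomp Require Import all_boot all_order all_algebra.
From mathcomp Require Import all_classical all_reals all_analysis.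

(** Read as an identity between maps of [z], the quasigroup law says
    [R_y \o L_(xy) = L_x \o L_y \o R_y]. Translations are continuous, hence
    Borel, so [mu] can be pushed forward along both sides one factor at a time:
    the two results are [rho y * j (xy)] and [j x * j y * rho y] times [mu].
    Comparing them on a single Borel set of positive finite measure gives the
    formula, and such a set is supplied by inner regularity of [mu] on the whole
    space: some compact set is not null, and compact sets have finite measure. *)

Set Implicit Arguments.
Unset Strict Implicit.
Unset Printing Implicit Defensive.

Import Order.TTheory GRing.Theory Num.Theory.

Local Open Scope classical_set_scope.
Local Open Scope ring_scope.

(** Preimages under [f] commute with complements and countable unions, so it is
    enough to treat the generating open sets. *)
Lemma continuous_borel_preimage (Q : ptopologicalType) (f : Q -> Q) :
  continuous f ->
  forall E : set (borel Q), measurable E -> measurable (f @^-1` E : set (borel Q)).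
Proof.
move=> fc E mE; rewrite -[_ @^-1` _]setTI.
have mf : measurable_fun [set: borel Q] (f : borel Q -> borel Q).
  apply: (@measurability _ _ (borel Q) (borel Q) setT f (@open Q) erefl).
  move=> _ [B oB <-].
  rewrite setTI; apply: sub_sigma_algebra.
  by apply: open_comp => // x _; exact: fc.
exact: mf.
Qed.

Section Translations.
Variables (Q : ptopologicalType) (op : Q -> Q -> Q).
Hypothesis op_continuous : continuous (fun p : Q * Q => op p.1 p.2).

Lemma measurable_ltranslation_preimage a (E : set (borel Q)) :
  measurable E -> measurable (ltranslation op a @^-1` E).
Proof.
apply: continuous_borel_preimage => x.
apply: (@continuous2_cvg _ _ _ _ _ _ (fun=> a) id op).
- exact: op_continuous (a, x).
- exact: cvg_cst.
- exact: cvg_id.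
Qed.

Lemma measurable_rtranslation_preimage a (E : set (borel Q)) :
  measurable E -> measurable (rtranslation op a @^-1` E).
Proof.
apply: continuous_borel_preimage => x.
apply: (@continuous2_cvg _ _ _ _ _ _ id (fun=> a) op).
- exact: op_continuous (x, a).
- exact: cvg_id.
- exact: cvg_cst.
Qed.

End Translations.

(** On a Borel set of positive finite measure, a scalar multiple of the measure
    determines the scalar; regularity provides such a set. *)
Lemma regular_measure_pos_fin (R : realType) (Q : ptopologicalType)
    (mu : {measure set (borel Q) -> \bar R}) :
  hausdorff_space Q -> regular_borel_measure mu -> nonzero_measure mu ->
  exists2 K : set (borel Q), measurable K & (0 < mu K < +oo)%E.
Proof.
move=> hQ [finK _ innU] [E mE muE].
have muT : (0 < mu [set: Q])%E.
  apply: (@lt_le_trans _ _ (mu E)); first by rewrite lt0e muE measure_ge0.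
  by apply: le_measure; rewrite ?inE.
move: muT; rewrite (innU setT openT) => /ereal_sup_gt[_ [K [cK _] <-]] muK.
exists K; last by rewrite muK finK.
(* The generators are open, so the closed set [K] enters by its complement. *)
rewrite -(setCK K); apply: measurableC; apply: sub_sigma_algebra.
exact: closed_openC (compact_closed hQ cK).
Qed.

Theorem theorem3 (R : realType) (Q : ptopologicalType) (op : Q -> Q -> Q)
    (tqQ : topological_quasigroup op)
    (lcQ : locally_compact [set: Q])
    (opI : forall x y z : Q, op (op (op x y) z) y = op x (op y (op z y)))
    (mu : {measure set (borel Q) -> \bar R})
    (mu_regular : regular_borel_measure mu)
    (mu_neq0 : nonzero_measure mu)
    (j rho : Q -> R)
    (j_gt0 : forall a : Q, 0 < j a)
    (rho_gt0 : forall a : Q, 0 < rho a)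
    (mu_L : forall a : Q, pushforward_scales mu (ltranslation op a) (j a))
    (mu_R : forall a : Q, pushforward_scales mu (rtranslation op a) (rho a)) :
  (forall x y : Q, j (op x y) * rho y = j x * j y * rho y) /\
  (forall x y : Q, j (op x y) = j x * j y).
Proof.
have [_ hQ opC _ _] := tqQ.
have mL := measurable_ltranslation_preimage opC.
have mR := measurable_rtranslation_preimage opC.
have main x y : j (op x y) * rho y = j x * j y * rho y.
  have [K mK /andP[K_gt0 K_fin]] := regular_measure_pos_fin hQ mu_regular mu_neq0.
  (* [opI] at [(x, y, z)] says that [z] is in both preimages or in neither. *)
  have eqK : ltranslation op (op x y) @^-1` (rtranslation op y @^-1` K) =
      rtranslation op y @^-1` (ltranslation op y @^-1` (ltranslation op x @^-1` K)).
    by apply/funext => z; exact: (congr1 (K : Q -> Prop) (opI x y z)).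
  have muL a (B : set (borel Q)) (mB : measurable B) : mu (ltranslation op a @^-1` B) =
    ((j a)%:E * mu B)%E := mu_L a B mB.
  have muR a (B : set (borel Q)) (mB : measurable B) : mu (rtranslation op a @^-1` B) =
    ((rho a)%:E * mu B)%E := mu_R a B mB.
  have := congr1 (fun A : set (borel Q) => mu A) eqK; cbv beta.
  rewrite (muL _ _ (mR _ _ mK)) (muR _ _ mK).
  rewrite (muR _ _ (mL _ _ (mL _ _ mK))) (muL _ _ (mL _ _ mK)) (muL _ _ mK).
  have muK_fin : mu K \is a fin_num by rewrite ge0_fin_numE // ltW.
  rewrite -(fineK muK_fin) -!EFinM => -[].
  have /lt0r_neq0 fK : 0 < fine (mu K) by rewrite fine_gt0 // K_gt0.
  rewrite !mulrA => /(mulIf fK) ->.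
  by rewrite -mulrA mulrC [j y * _]mulrC.
split=> // x y.
exact: (mulIf (lt0r_neq0 (rho_gt0 y)) (main x y)).
Qed.
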